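(* Let $G$ be a group, let $S$ be a ring which is epsilon-strongly graded by $G$, and put $R=S_e$. If $R$ is a maximal commutative subring of $S$, then $S$ is simple if and only if $S$ is graded simple.
   Context: Rings are associative with a nonzero multiplicative identity $1$; ideals are two-sided. For additive subgroups $X,Y\subseteq S$, $XY$ denotes the set of finite sums of products $xy$ with $x\in X$, $y\in Y$. Let $e$ be the identity of $G$. $S$ is graded by $G$ if there are additive subgroups $S_g\subseteq S$ ($g\in G$) with $S=\bigoplus_{g\in G}S_g$ and $S_gS_h\subseteq S_{gh}$ for all $g,h\in G$; $R=S_e$. An ideal of $R$ is called unital if it has its own multiplicative identity element (allowed to be $0$). $S$ is epsilon-strongly graded by $G$ if for each $g\in G$, $S_gS_{g^{-1}}$ is a unital ideal of $R$, and for all $g,h\in G$ the equalities $S_gS_h = S_gS_{g^{-1}}S_{gh} = S_{gh}S_{h^{-1}}S_h$ hold. For a non-empty $T\subseteq S$, $C_S(T)$ is the set of $s\in S$ with $st=ts$ for all $t\in T$. $R$ is called a maximal commutative subring of $S$ if $C_S(R)=R$. An ideal $I$ of $S$ is graded if $I=\bigoplus_{g\in G}(I\cap S_g)$. $S$ is graded simple if $\{0\}$ and $S$ are its only graded ideals; $S$ is simple if $\{0\}$ and $S$ are its only ideals. *)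

(* Defs.v *)
From mathcomp Require Export all_boot all_algebra.
From mathcomp Require Export boolp classical_sets cardinality fsbigop.

Set Implicit Arguments.
Unset Strict Implicit.
Unset Printing Implicit Defensive.

Local Open Scope classical_set_scope.
Local Open Scope ring_scope.

Section Subsets.
Variable S : nzRingType.
Implicit Types X Y R I T : set S.

Definition additive_subgroup X : Prop := zmod_closed (mem X).

Definition set_mulr X Y : set S :=
  [set s | exists (n : nat) (x y : 'I_n -> S),
     [/\ forall i, X (x i), forall i, Y (y i) & s = \sum_(i < n) x i * y i]].

(* Two-sided ideals, not required to be proper; R is meant to be the carrier
   of a subring of S, and R = setT gives the ideals of S itself. *)
Definition is_ideal R I : Prop :=
  [/\ additive_subgroup I, I `<=` R
    & forall r x, R r -> I x -> I (r * x) /\ I (x * r)].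

Definition is_unital I : Prop :=
  exists2 u, I u & forall x, I x -> u * x = x /\ x * u = x.

Definition centralizer T : set S := [set s | forall t, T t -> s * t = t * s].

Definition maximal_commutative R : Prop := centralizer R = R.

End Subsets.

Definition is_simple (S : nzRingType) : Prop :=
  forall I : set S, is_ideal setT I -> I = [set 0] \/ I = setT.

Section Graded.
Variables (G : groupType) (S : nzRingType).
Implicit Types (A I : set S) (X Sg : G -> set S).

(* The finiteness condition is essential: \sum_(g \in setT) f g is 0 by
   convention when f has infinite support. *)
Definition is_decomposition X (f : G -> S) (s : S) : Prop :=
  [/\ forall g, X g (f g), finite_set [set g | f g <> 0]
    & s = \sum_(g \in [set: G]) f g].

Definition is_direct_sum A X : Prop :=
  (forall s, A s <-> exists f, is_decomposition X f s) /\
  (forall s f f', is_decomposition X f s -> is_decomposition X f' s -> f = f').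

Definition is_graded Sg : Prop :=
  [/\ forall g, additive_subgroup (Sg g), is_direct_sum setT Sg
    & forall g h, set_mulr (Sg g) (Sg h) `<=` Sg (g * h)%g].

Definition is_epsilon_strongly_graded Sg : Prop :=
  [/\ is_graded Sg,
      forall g, is_ideal (Sg 1%g) (set_mulr (Sg g) (Sg g^-1%g)) /\
                is_unital (set_mulr (Sg g) (Sg g^-1%g))
    & forall g h,
        set_mulr (Sg g) (Sg h) =
          set_mulr (set_mulr (Sg g) (Sg g^-1%g)) (Sg (g * h)%g) /\
        set_mulr (Sg g) (Sg h) =
          set_mulr (set_mulr (Sg (g * h)%g) (Sg h^-1%g)) (Sg h)].

Definition is_graded_ideal Sg I : Prop :=
  is_ideal setT I /\ is_direct_sum I (fun g => I `&` Sg g).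

Definition is_graded_simple Sg : Prop :=
  forall I, is_graded_ideal Sg I -> I = [set 0] \/ I = setT.

End Graded.

(* Main.v *)
Require Import Defs.

(** Only the passage from graded simple to simple has content. Let [I] be a
    nonzero ideal of [S].

    The crux is that [I] meets [R = Sg 1] nontrivially
    ([ideal_meets_identity_component]). Take [s] in [I], nonzero, with as few
    homogeneous components as possible. Epsilon-strong gradings are
    nondegenerate ([epsilon_strong_nondegenerate]): multiplying [s] on the
    right by a suitable homogeneous element moves a nonzero component into
    degree [1], with no more components than before. For [r] in [R], the
    commutator [r * s - s * r] is again in [I], and its degree [1] component
    vanishes because [R] is commutative; it thus has fewer components than [s]
    and must be [0]. So [s] centralizes [R], and maximal commutativity puts [s]
    in [R].

    The elements all of whose homogeneous components lie in [I] form a graded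
    ideal inside [I] ([graded_part_is_graded_ideal]). It contains [I] meet [R],
    so it is nonzero, and graded simplicity makes it, and hence [I], the whole
    of [S]. *)

Set Implicit Arguments.
Unset Strict Implicit.
Unset Printing Implicit Defensive.

Import GRing.Theory.
Local Open Scope classical_set_scope.
Local Open Scope ring_scope.

(** * Additive subgroups and products of subsets *)

Lemma additive_subgroup0 (S : nzRingType) (X : set S) :
  additive_subgroup X -> X 0.
Proof. by case; rewrite inE. Qed.

Lemma additive_subgroupB (S : nzRingType) (X : set S) x y :
  additive_subgroup X -> X x -> X y -> X (x - y).
Proof. by case=> _ subX Xx Xy; apply/set_mem/subX; apply: mem_set. Qed.

Lemma additive_subgroupD (S : nzRingType) (X : set S) x y :
  additive_subgroup X -> X x -> X y -> X (x + y).
Proof.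
move=> addX Xx Xy; rewrite -[y]opprK -[- y]sub0r.
by do !apply: additive_subgroupB => //; apply: additive_subgroup0.
Qed.

Lemma additive_subgroup_sum (S : nzRingType) (X : set S) (J : Type)
    (r : seq J) (F : J -> S) :
  additive_subgroup X -> (forall j, X (F j)) -> X (\sum_(j <- r) F j).
Proof.
move=> addX XF; apply: big_ind => //; first exact: additive_subgroup0.
by move=> x y; apply: additive_subgroupD.
Qed.

Lemma additive_subgroupI (S : nzRingType) (X Y : set S) :
  additive_subgroup X -> additive_subgroup Y -> additive_subgroup (X `&` Y).
Proof.
move=> addX addY; split; first by rewrite inE; split; apply: additive_subgroup0.
move=> x y; rewrite !inE => -[Xx Yx] [Xy Yy].
by split; apply: additive_subgroupB.
Qed.

Lemma set_mulr_mul (S : nzRingType) (X Y : set S) x y :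
  X x -> Y y -> set_mulr X Y (x * y).
Proof.
by move=> Xx Yy; exists 1%N, (fun=> x), (fun=> y); split=> //; rewrite big_ord1.
Qed.

(** * Decompositions into homogeneous components *)

(** Replacing the finite support by any list containing it lets two
    decompositions be summed over a common list. *)
Lemma is_decompositionP (G : groupType) (S : nzRingType) (X : G -> set S)
    (f : G -> S) (s : S) :
  is_decomposition X f s <->
  (forall g, X g (f g)) /\
  exists l : seq G, [/\ uniq l, forall g, f g <> 0 -> g \in l
                      & s = \sum_(g <- l) f g].
Proof.
have sumE (l : seq G) : uniq l -> (forall g, f g <> 0 -> g \in l) ->
    \sum_(g \in [set: G]) f g = \sum_(g <- l) f g.
  move=> l_uniq suppl; rewrite (@fsbigE _ _ _ _ _ l) //.
    by apply: eq_bigl => g; rewrite in_setT.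
  by move=> g _ /negP lg; have [//|/eqP/suppl] := eqVneq (f g) 0.
split=> [[Xf /finite_seqP[l suppE] ->]|[Xf [l [l_uniq suppl ->]]]].
  have suppl g : f g <> 0 -> g \in undup l.
    by rewrite mem_undup => fg; have : [set` l] g by rewrite -suppE.
  have ul := undup_uniq l.
  by split=> //; exists (undup l); split=> //; apply: sumE.
split=> //; last by rewrite (sumE l).
by apply: (@sub_finite_set _ _ [set` l]) => //; apply/finite_seqP; exists l.
Qed.

Section Decomposition.
Variables (G : groupType) (S : nzRingType) (X : G -> set S).
Implicit Types (f : G -> S) (s a : S) (l : seq G).

Lemma decomposition_sum f s l :
    is_decomposition X f s -> uniq l -> (forall g, f g <> 0 -> g \in l) ->
  s = \sum_(g <- l) f g.
Proof.
move=> /is_decompositionP[Xf [l0 [l0_uniq suppl0 ->]]] l_uniq suppl.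
have restrict (r r' : seq G) : (forall g, f g <> 0 -> g \in r') ->
    \sum_(g <- r) f g = \sum_(g <- r | g \in r') f g.
  move=> suppr'; apply/esym/big_rmcond_in => g _ /negP r'g.
  by have [//|/eqP/suppr'] := eqVneq (f g) 0.
rewrite (restrict l0 l) // (restrict l l0) //.
rewrite -[LHS]big_filter -[RHS]big_filter.
apply: perm_big; apply: uniq_perm.
- exact: filter_uniq.
- exact: filter_uniq.
- by move=> g; rewrite !mem_filter andbC.
Qed.

Lemma decompositionB f f' s s' :
    (forall g, additive_subgroup (X g)) ->
    is_decomposition X f s -> is_decomposition X f' s' ->
  is_decomposition X (fun g => f g - f' g) (s - s').
Proof.
move=> addX df df'.
have /is_decompositionP[Xf [l [l_uniq suppl _]]] := df.
have /is_decompositionP[Xf' [l' [l'_uniq suppl' _]]] := df'.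
have ll'_uniq := undup_uniq (l ++ l').
have fP g : f g <> 0 -> g \in undup (l ++ l').
  by move=> /suppl lg; rewrite mem_undup mem_cat lg.
have f'P g : f' g <> 0 -> g \in undup (l ++ l').
  by move=> /suppl' lg; rewrite mem_undup mem_cat lg orbT.
apply/is_decompositionP; split; first by move=> g; apply: additive_subgroupB.
exists (undup (l ++ l')); split => //.
  move=> g; have [fg0|/eqP/fP //] := eqVneq (f g) 0.
  by have [->|/eqP/f'P //] := eqVneq (f' g) 0; rewrite fg0 subrr.
by rewrite (decomposition_sum df ll'_uniq fP)
   (decomposition_sum df' ll'_uniq f'P) sumrB.
Qed.

(** Left multiplication by a homogeneous element shifts all degrees, whence
    the translation in the argument of [f]. *)
Lemma decompositionMl h a f s :
    (forall k x, X k x -> X (h * k)%g (a * x)) -> is_decomposition X f s ->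
  is_decomposition X (fun k => a * f (h^-1 * k)%g) (a * s).
Proof.
move=> aX /is_decompositionP[Xf [l [l_uniq suppl ->]]].
apply/is_decompositionP; split; first by move=> k; rewrite -{1}(mulVKg h k); apply: aX.
exists [seq (h * k)%g | k <- l]; split.
- by rewrite map_inj_uniq //; apply: mulgI.
- move=> k afk; apply/mapP; exists (h^-1 * k)%g; last by rewrite mulVKg.
  by apply: suppl => fk0; apply: afk; rewrite fk0 mulr0.
- by rewrite big_map mulr_sumr; apply: eq_bigr => k _; rewrite mulKg.
Qed.

Lemma decompositionMr h a f s :
    (forall k x, X k x -> X (k * h)%g (x * a)) -> is_decomposition X f s ->
  is_decomposition X (fun k => f (k * h^-1)%g * a) (s * a).
Proof.
move=> Xa /is_decompositionP[Xf [l [l_uniq suppl ->]]].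
apply/is_decompositionP; split; first by move=> k; rewrite -{1}(mulgVK h k); apply: Xa.
exists [seq (k * h)%g | k <- l]; split.
- by rewrite map_inj_uniq //; apply: mulIg.
- move=> k fka; apply/mapP; exists (k * h^-1)%g; last by rewrite mulgVK.
  by apply: suppl => fk0; apply: fka; rewrite fk0 mul0r.
- by rewrite big_map mulr_suml; apply: eq_bigr => k _; rewrite mulgK.
Qed.

Lemma decomposition_homogeneous h a :
    (forall g, X g 0) -> X h a ->
  is_decomposition X (fun g => if g == h then a else 0) a.
Proof.
move=> X0 Xa; apply/is_decompositionP; split; first by move=> g; case: eqP => [->|].
exists [:: h]; split=> //; first by move=> g; case: eqP => [->|//]; rewrite inE.
by rewrite big_seq1 eqxx.
Qed.

Lemma decomposition0 :
  (forall g, X g 0) -> is_decomposition X (fun=> 0) 0.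
Proof.
move=> X0; apply/is_decompositionP; split=> //.
by exists [::]; split=> //; rewrite big_nil.
Qed.

Lemma decomposition_sub (Y : G -> set S) f s :
    (forall g, X g `<=` Y g) -> is_decomposition X f s ->
  is_decomposition Y f s.
Proof. by move=> XY [Xf fin_f sE]; split=> // g; apply/XY. Qed.

End Decomposition.

(** * The largest graded ideal inside an ideal *)

Definition graded_part (G : groupType) (S : nzRingType) (Sg : G -> set S)
    (I : set S) : set S :=
  [set s | exists f, is_decomposition (fun g => I `&` Sg g) f s].

Section GradedPart.
Variables (G : groupType) (S : nzRingType) (Sg : G -> set S).
Hypothesis Sg_graded : is_graded Sg.

Lemma graded_mul g h x y : Sg g x -> Sg h y -> Sg (g * h)%g (x * y).
Proof. by case: Sg_graded => _ _ SgM Sx Sy; apply/SgM/set_mulr_mul. Qed.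

Variable I : set S.
Hypothesis I_ideal : is_ideal setT I.

Let homog_add g : additive_subgroup (I `&` Sg g).
Proof.
case: I_ideal Sg_graded => addI _ _ [addSg _ _].
exact: additive_subgroupI.
Qed.

Lemma graded_part_sub : graded_part Sg I `<=` I.
Proof.
move=> s [f /is_decompositionP[If [l [_ _ ->]]]].
case: I_ideal => addI _ _; apply: additive_subgroup_sum => // k.
by case: (If k).
Qed.

Lemma graded_part_homogeneous g : graded_part Sg I `&` Sg g = I `&` Sg g.
Proof.
apply/seteqP; split=> s []; first by move=> /graded_part_sub.
move=> Is Ss; split=> //; exists (fun k => if k == g then s else 0).
apply: decomposition_homogeneous => // k.
exact: (additive_subgroup0 (homog_add k)).
Qed.

Lemma graded_part_additive : additive_subgroup (graded_part Sg I).
Proof.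
split.
  rewrite inE; exists (fun=> 0); apply: decomposition0 => g.
  exact: (additive_subgroup0 (homog_add g)).
move=> s s'; rewrite !inE => -[f df] [f' df'].
by exists (fun g => f g - f' g); apply: decompositionB.
Qed.

(** Multiplying by an arbitrary [r] mixes degrees, but [r] is a sum of
    homogeneous elements, and each of these only shifts degrees; additivity
    does the rest. *)
Lemma graded_part_is_graded_ideal : is_graded_ideal Sg (graded_part Sg I).
Proof.
case: (I_ideal) (Sg_graded) => addI _ IM [addSg [SgT Sg_uniq] _].
split; last first.
  have -> : (fun g => graded_part Sg I `&` Sg g) = (fun g => I `&` Sg g).
    by apply/funext => g; apply: graded_part_homogeneous.
  split=> // s f f' df df'; apply: (Sg_uniq s).
    by apply: decomposition_sub df => g x [].
  by apply: decomposition_sub df' => g x [].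
split=> //; first exact: graded_part_additive.
move=> r s _ [f df].
have /SgT[c /is_decompositionP[Sc [l [_ _ ->]]]] : [set: S] r by [].
split.
  rewrite mulr_suml; apply: additive_subgroup_sum => [|h].
    exact: graded_part_additive.
  exists (fun k => c h * f (h^-1 * k)%g); apply: decompositionMl df => k x [Ix Sx].
  by split; [case: (IM (c h) x)|apply: graded_mul].
rewrite mulr_sumr; apply: additive_subgroup_sum => [|h].
  exact: graded_part_additive.
exists (fun k => f (k * h^-1)%g * c h); apply: decompositionMr df => k x [Ix Sx].
by split; [case: (IM (c h) x)|apply: graded_mul].
Qed.

End GradedPart.

(** * Ideals meet the degree one component *)

Section EpsilonStrong.
Variables (G : groupType) (S : nzRingType) (Sg : G -> set S).
Hypothesis Sg_eps : is_epsilon_strongly_graded Sg.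

Let Sg_graded : is_graded Sg. Proof. by case: Sg_eps. Qed.

(** As [x = x * 1] lies in [Sg g * Sg g^-1 * Sg g], the identity [u] of
    [Sg g^-1 * Sg g] fixes [x] on the right. If every [x * y] vanished, then so
    would [x * u], because [u] is a sum of products with left factors in
    [Sg g^-1]. *)
Lemma epsilon_strong_nondegenerate g x :
    Sg 1%g 1 -> Sg g x -> x <> 0 ->
  exists2 y, Sg g^-1%g y & x * y <> 0.
Proof.
move=> S1 Sx x0; apply: contrapT => noy.
have xy0 y : Sg g^-1%g y -> x * y = 0.
  by move=> Sy; apply: contrapT => xy; apply: noy; exists y.
case: Sg_eps => _ unitSg SgSg.
have [_ [u]] := unitSg g^-1%g; rewrite invgK => Su uP.
have [mulE _] := SgSg g 1%g.
have : set_mulr (Sg g) (Sg 1%g) (x * 1) by apply: set_mulr_mul.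
rewrite mulE mulg1 mulr1 => -[n [a [b [aP bP xE]]]].
apply: x0.
have xuE : x * u = x.
  rewrite {1}xE mulr_suml xE; apply: eq_bigr => i _.
  have [m [c [d [cP dP ->]]]] := aP i.
  rewrite !mulr_suml; apply: eq_bigr => j _.
  rewrite -!mulrA; congr (_ * _); rewrite mulrA.
  by case: (uP (d j * b i)) => //; apply: set_mulr_mul.
rewrite -xuE; case: Su => m [c [d [cP dP ->]]].
by rewrite mulr_sumr big1 // => i _; rewrite mulrA xy0 ?mul0r.
Qed.

Hypothesis R_max_comm : maximal_commutative (Sg 1%g).

(** The minimality argument is run as a descent on a bound [n] for the number
    of components. *)
Lemma ideal_meets_identity_component (I : set S) s :
    is_ideal setT I -> I s -> s <> 0 ->
  exists r, [/\ I r, Sg 1%g r & r <> 0].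
Proof.
move=> [addI _ IM] Is s0.
have S1 : Sg 1%g 1 by rewrite -R_max_comm => t _; rewrite mul1r mulr1.
have Rcomm x y : Sg 1%g x -> Sg 1%g y -> x * y = y * x.
  by rewrite -{1}R_max_comm => xR; apply: xR.
have [addSg [SgT _] _] := Sg_graded.
have /SgT[f df] : [set: S] s by [].
have /is_decompositionP[_ [l [_ suppl _]]] := df.
have [n] := ubnP (size l).
elim: n => // n IHn in s f l Is s0 df suppl *; rewrite ltnS => len_l.
have [g fg0] : exists g, f g <> 0.
  apply: contrapT => nog; apply: s0; rewrite (decomposition_sum df (l := [::])) ?big_nil //.
  by move=> g fg0; case: nog; exists g.
have [Sf _ _] := df.
have [y Sy fgy0] := epsilon_strong_nondegenerate S1 (Sf g) fg0.
(* The component of degree [g] moves to degree [1]. *)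
pose t := s * y; pose f1 k := f (k * g)%g * y.
have df1 : is_decomposition Sg f1 t.
  have := decompositionMr (fun k x (Skx : Sg k x) => graded_mul Sg_graded Skx Sy) df.
  by rewrite invgK.
have It : I t by case: (IM y s).
have f1_1 : f1 1%g <> 0 by rewrite /f1 mul1g.
pose l1 := [seq (k * g^-1)%g | k <- l].
have suppl1 k : f1 k <> 0 -> k \in l1.
  move=> f1k; apply/mapP; exists (k * g)%g; last by rewrite mulgK.
  by apply: suppl => fk0; apply: f1k; rewrite /f1 fk0 mul0r.
have t0 : t <> 0.
  move=> t0; apply: f1_1.
  have [_ [_ Sg_uniq] _] := Sg_graded.
  have d0 : is_decomposition Sg (fun=> 0) t.
    by rewrite t0; apply: decomposition0 => k; apply: additive_subgroup0.
  by rewrite (Sg_uniq _ _ _ df1 d0).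
have [tR|] := pselect (centralizer (Sg 1%g) t).
  by exists t; split=> //; rewrite -R_max_comm.
move=> /existsNP[r /not_implyP[Rr /eqP]]; rewrite -subr_eq0 => /eqP tr0.
have dMr := decompositionMr (fun k x (Skx : Sg k x) => graded_mul Sg_graded Skx Rr) df1.
have dMl := decompositionMl (fun k x (Skx : Sg k x) => graded_mul Sg_graded Rr Skx) df1.
have dcomm := decompositionB addSg dMr dMl.
apply: (IHn _ _ [seq k <- l1 | k != 1%g] _ tr0 dcomm).
- by case: (IM r t) => // Irt Itr; apply: additive_subgroupB.
- move=> k; rewrite mem_filter !invg1 mulg1 mul1g => fk.
  apply/andP; split.
    apply/eqP => k1; apply: fk; rewrite k1 Rcomm ?subrr //.
    by case: df1.
  apply: suppl1 => f1k; apply: fk.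
  by rewrite f1k mulr0 mul0r subrr.
- (* The list gets strictly shorter because [1] belongs to [l1]. *)
  apply: leq_trans len_l; rewrite -(size_map (fun k => (k * g^-1)%g) l) -/l1.
  rewrite size_filter -(count_predC (pred1 1%g) l1) -[X in (X < _)%N]add0n ltn_add2r.
  by rewrite -has_count has_pred1 suppl1.
Qed.

End EpsilonStrong.

Theorem proposition29 (G : groupType) (S : nzRingType) (Sg : G -> set S)
    (S_graded : is_epsilon_strongly_graded Sg)
    (R_max_comm : maximal_commutative (Sg 1%g)) :
  is_simple S <-> is_graded_simple Sg.
Proof.
split=> [S_simple I [I_ideal _]|S_gsimple I I_ideal]; first exact: S_simple.
have [Sg_graded _ _] := S_graded.
have [I0|/existsNP[s /not_implyP[Is s0]]] := pselect (forall s, I s -> s = 0).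
  left; apply/seteqP; split=> [s /I0 //|_ ->].
  by case: I_ideal => addI _ _; apply: additive_subgroup0.
right.
have [r [Ir Rr r0]] :=
  ideal_meets_identity_component S_graded R_max_comm I_ideal Is s0.
have Kr : graded_part Sg I r.
  by have [] : (graded_part Sg I `&` Sg 1%g) r by rewrite graded_part_homogeneous.
have [K0|KT] := S_gsimple _ (graded_part_is_graded_ideal Sg_graded I_ideal).
  by case: r0; move: Kr; rewrite K0.
apply/seteqP; split=> // x _; apply: (graded_part_sub I_ideal (Sg := Sg)).
by rewrite KT.
Qed.
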